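(* Let $A\in\mathbb R^{m\times N}$, $y\in\mathbb R^m$, $C\in\mathbb R^{p\times N}$, $d\in\mathbb R^p$. Let $x^*$ be a feasible point of the problem $$\min_{x\in\mathbb R^N}\|x\|_1\quad\text{subject to}\quad Ax=y,\ \ Cx\ge d,$$ and let $\alpha$, $\mathcal S$, $\widehat b$ be as defined in the context. Then $x^*$ is the unique minimizer if and only if the following conditions hold: (i) the matrix $\begin{bmatrix}A_{\bullet\mathcal S}\\C_{\alpha\mathcal S}\end{bmatrix}$ has full column rank; and (ii) there exist $u\in\mathbb R^m$ and $u'\in\mathbb R^{|\alpha|}_{++}$ such that $A_{\bullet\mathcal S}^Tu+C_{\alpha\mathcal S}^Tu'=\widehat b$ and $\big\|A_{\bullet\mathcal S^c}^Tu+C_{\alpha\mathcal S^c}^Tu'\big\|_\infty<1$.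
   Context: Vector inequalities are componentwise; $\mathbb R^n_{++}$ is the set of vectors with strictly positive entries. $M_{\bullet\beta}$ is the submatrix of $M$ with columns indexed by $\beta$, and $M_{\alpha\beta}$ that with rows in $\alpha$ and columns in $\beta$. Given $x^*$: $\alpha:=\{i\in\{1,\ldots,p\}\mid(Cx^*-d)_i=0\}$; $\mathcal S:=\{i\in\{1,\ldots,N\}\mid x^*_i\ne0\}$ with complement $\mathcal S^c$; $\widehat b:=\mathrm{sgn}(x^*_{\mathcal S})\in\{\pm1\}^{|\mathcal S|}$ (componentwise sign). A matrix with no columns is regarded as having full column rank, and the $\infty$-norm of an empty vector is $0$. *)

(* Defs.v *)
From HB Require Import structures.
From mathcomp Require Import all_boot all_order all_algebra.
From mathcomp Require Import reals matrix_normedtype.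

Set Implicit Arguments.
Unset Strict Implicit.
Unset Printing Implicit Defensive.

Import Order.TTheory GRing.Theory Num.Theory.

Local Open Scope ring_scope.

(* A subvector or submatrix indexed by a set S is indexed by 'I_#|S|; its k-th
   index stands for the k-th element of S in increasing order. *)
Definition set_idx (n : nat) (S : {set 'I_n}) (k : 'I_#|S|) : 'I_n :=
  enum_val k.

Definition cols (R : Type) (m n : nat) (S : {set 'I_n}) (M : 'M[R]_(m, n)) :
    'M[R]_(m, #|S|) :=
  colsub (@set_idx n S) M.

Definition rows_cols (R : Type) (m n : nat) (T : {set 'I_m}) (S : {set 'I_n})
    (M : 'M[R]_(m, n)) : 'M[R]_(#|T|, #|S|) :=
  mxsub (@set_idx m T) (@set_idx n S) M.

Definition subvec (R : Type) (n : nat) (S : {set 'I_n}) (x : 'cV[R]_n) :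
    'cV[R]_#|S| :=
  rowsub (@set_idx n S) x.

Definition full_column_rank (R : fieldType) (m n : nat) (M : 'M[R]_(m, n)) :=
  \rank M = n.

Definition norm1 (R : realType) (n : nat) (x : 'cV[R]_n) : R :=
  \sum_i `|x i 0|.

(* mx_norm is the largest absolute value of an entry, and 0 if there is none. *)
Definition norm_infty (R : realType) (n : nat) (x : 'cV[R]_n) : R := mx_norm x.

Definition vec_ge (R : realType) (n : nat) (a b : 'cV[R]_n) : Prop :=
  forall i, b i 0 <= a i 0.

Definition vec_pos (R : realType) (n : nat) (a : 'cV[R]_n) : Prop :=
  forall i, 0 < a i 0.

Definition sgn_vec (R : realType) (n : nat) (x : 'cV[R]_n) : 'cV[R]_n :=
  map_mx Num.sg x.

Definition feasible (R : realType) (m N p : nat) (A : 'M[R]_(m, N))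
    (y : 'cV[R]_m) (C : 'M[R]_(p, N)) (d : 'cV[R]_p) (x : 'cV[R]_N) : Prop :=
  A *m x = y /\ vec_ge (C *m x) d.

Definition minimizer (R : realType) (m N p : nat) (A : 'M[R]_(m, N))
    (y : 'cV[R]_m) (C : 'M[R]_(p, N)) (d : 'cV[R]_p) (x : 'cV[R]_N) : Prop :=
  feasible A y C d x /\
  (forall z : 'cV[R]_N, feasible A y C d z -> norm1 x <= norm1 z).

Definition active_set (R : realType) (N p : nat) (C : 'M[R]_(p, N))
    (d : 'cV[R]_p) (x : 'cV[R]_N) : {set 'I_p} :=
  [set i | (C *m x - d) i 0 == 0].

Definition supp (R : realType) (N : nat) (x : 'cV[R]_N) : {set 'I_N} :=
  [set i | x i 0 != 0].

(* Main.v *)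
(* The l1 norm and the feasible set are polyhedral, so [x] is the unique minimizer
   iff the directional derivative bhat^T h_S + |h_Sc|_1 is positive along every
   nonzero h with A h = 0 and C_alpha h >= 0. Conditions (i) and (ii) imply this
   because (ii) writes the derivative as the sum of |h_i| - w_i h_i over Sc, with
   |w_i| < 1, and of u'_i (C h)_i over alpha. Conversely, (i) follows by moving
   along h and -h for h in the kernel, and (ii) is Stiemke's theorem of the
   alternative applied to the system stating that the derivative is nonpositive. *)
Require Import Defs.
From HB Require Import structures.
From mathcomp Require Import all_boot all_order all_algebra.
From mathcomp Require Import reals matrix_normedtype.
From mathcomp Require Import lra.

Set Implicit Arguments.
Unset Strict Implicit.
Unset Printing Implicit Defensive.

Import Order.TTheory GRing.Theory Num.Theory.

Local Open Scope ring_scope.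

(** * Theorems of the alternative for linear systems *)

Lemma mulmx_ge0 (R : realFieldType) (k l n : nat) (A : 'M[R]_(k, l))
    (B : 'M[R]_(l, n)) :
  (forall i j, 0 <= A i j) -> (forall i j, 0 <= B i j) ->
  forall i j, 0 <= (A *m B) i j.
Proof.
by move=> A0 B0 i j; rewrite mxE sumr_ge0 // => l' _; rewrite mulr_ge0.
Qed.

(** Induction on the rows. If the separating [x] for the remaining rows violates the first row [a],
    the induction hypothesis is reapplied to [M *m P] and [c *m P], where [a *m P = 0]; a separating
    [z] there pulls back to [P *m z]. *)
Lemma farkas (R : realFieldType) (k n : nat) (M : 'M[R]_(k, n)) (c : 'rV[R]_n) :
  (exists2 y : 'rV[R]_k, (forall i j, 0 <= y i j) & c = y *m M) \/
  (exists2 x : 'cV[R]_n, (forall i j, 0 <= (M *m x) i j) & (c *m x) 0 0 < 0).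
Proof.
elim: k => [|k IHk] in M c *.
  have [->|c0] := eqVneq c 0.
    by left; exists 0 => [i j|]; rewrite ?mxE // mul0mx.
  right; exists (- c^T) => [[]//|]; rewrite mulmxN mxE oppr_lt0 mxE.
  have [j cj] : exists j, c 0 j != 0 by apply/rV0Pn.
  rewrite (bigD1 j) //= ltr_wpDr //; last first.
    by rewrite mxE lt_neqAle eq_sym mulf_neq0 // -expr2 sqr_ge0.
  by apply: sumr_ge0 => l _; rewrite mxE -expr2 sqr_ge0.
move: M; rewrite -[k.+1]/(1 + k)%N => M.
rewrite -[M]vsubmxK; move: (usubmx _) (dsubmx _) => a {}M.
have [[y y0 cE]|[x Mx cx]] := IHk M c.
  left; exists (row_mx (0 : 'rV_1) y); last by rewrite mul_row_col mul0mx add0r.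
  by move=> i j; rewrite mxE; case: split => l; rewrite ?mxE.
have [ax|ax] := leP 0 ((a *m x) 0 0).
  right; exists x => // i j; rewrite mul_col_mx mxE.
  by case: split => l //; rewrite !ord1.
pose q := ((a *m x) 0 0)^-1.
have axq : a *m x *m a = q^-1 *: a.
  by rewrite [a *m x]mx11_scalar mul_scalar_mx invrK.
have q0 : q < 0 by rewrite invr_lt0.
(* [P] projects along [x] onto the hyperplane orthogonal to [a]. *)
pose P := 1%:M - q *: (x *m a).
have aP : a *m P = 0.
  rewrite mulmxBr mulmx1 -scalemxAr mulmxA axq scalerA mulfV ?lt_eqF //.
  by rewrite scale1r subrr.
have [[y y0 cE]|[z Mz cz]] := IHk (M *m P) (c *m P).
  (* Since [(c - y *m M) *m P = 0], the row [c - y *m M] is this multiple of [a]. The multiplier is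
     nonnegative because [q < 0] and [c *m x < 0 <= y *m M *m x]. *)
  left; exists (row_mx (q *: ((c - y *m M) *m x)) y).
    move=> i j; rewrite mxE; case: split => l //.
    have yMx : 0 <= (y *m (M *m x)) 0 0 by apply: mulmx_ge0.
    rewrite !ord1 mxE mulmxBl -mulmxA.
    move: (c *m x) (y *m _) cx yMx => u v u0 v0.
    by rewrite !mxE nmulr_rge0 // subr_le0 (le_trans (ltW u0)).
  apply/eqP; rewrite mul_row_col -subr_eq -scalemxAl -mulmxA scalemxAr.
  by rewrite -subr_eq0 -{1}[c - _]mulmx1 -mulmxBr mulmxBl cE mulmxA subrr.
right; exists (P *m z); last by rewrite mulmxA.
move=> i j; rewrite mul_col_mx mulmxA aP mul0mx mulmxA mxE.
by case: split => l //; rewrite mxE.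
Qed.

(** Farkas applied to [- row i M] gives a nonnegative [Y i] with [Y i *m M = - row i M], the other
    alternative being excluded by hypothesis. Adding the i-th unit vector makes entry i positive,
    and summing over i makes every entry positive. *)
Lemma stiemke (R : realFieldType) (k n : nat) (M : 'M[R]_(k, n)) :
  (forall x : 'cV[R]_n, (forall i j, 0 <= (M *m x) i j) -> M *m x = 0) ->
  exists2 y : 'cV[R]_k, (forall i j, 0 < y i j) & M^T *m y = 0.
Proof.
move=> M0.
have /fin_all_exists2[Y Y0 YE] i :
    exists2 y : 'rV[R]_k, (forall i j, 0 <= y i j) & - row i M = y *m M.
  have [//|[x Mx]] := farkas M (- row i M).
  by rewrite mulNmx -row_mul (M0 x Mx) !mxE oppr0 ltxx.
pose W := \matrix_i Y i.
have WM : W *m M = - M.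
  by apply/row_matrixP => i; rewrite row_mul rowK -YE linearN.
exists ((const_mx 1 *m (W + 1%:M))^T).
  move=> i j; rewrite 2!mxE (bigD1 i) //= !mxE eqxx mul1r ltr_wpDr //.
    by apply: sumr_ge0 => l _; rewrite !mxE mul1r addr_ge0 // ler0n.
  by rewrite ltr_wpDl.
by rewrite -trmx_mul -mulmxA mulmxDl WM mul1mx addNr mulmx0 trmx0.
Qed.

Lemma forall_col_mx (T : Type) (P : T -> Prop) (m1 m2 n : nat)
    (a : 'M[T]_(m1, n)) (b : 'M[T]_(m2, n)) :
  (forall i j, P (col_mx a b i j)) <->
  (forall i j, P (a i j)) /\ (forall i j, P (b i j)).
Proof.
split=> [H | [Ha Hb] i j]; last by rewrite mxE; case: split.
by split=> i j; [move: (H (lshift m2 i) j) | move: (H (rshift m1 i) j)];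
  rewrite ?col_mxEu ?col_mxEd.
Qed.

Lemma exists_small_step (R : realFieldType) (I : finType) (P : pred I)
    (a b : I -> R) :
  (forall i, P i -> 0 < a i) ->
  exists2 e, 0 < e & forall i, P i -> e * b i <= a i.
Proof.
(* The sum stands in for the largest ratio; the summand 1 keeps [s] positive even when [P] is
   empty. *)
move=> a0; pose s := 1 + \sum_(i | P i) `|b i| / a i.
have s_ge0 i : P i -> 0 <= `|b i| / a i.
  by move=> Pi; rewrite divr_ge0 // ltW // a0.
have s0 : 0 < s by rewrite ltr_pwDl // sumr_ge0.
exists s^-1 => [|i Pi]; first by rewrite invr_gt0.
rewrite mulrC ler_pdivrMr // (le_trans (ler_norm _)) // mulrC.
rewrite -ler_pdivrMr ?a0 // /s (bigD1 i) //= addrCA lerDl addr_ge0 //.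
by rewrite sumr_ge0 // => j /andP[Pj _]; apply: s_ge0.
Qed.

(** * Splitting vectors and products along an index set *)

Lemma sum_set_idx (R : nmodType) (n : nat) (S : {set 'I_n}) (F : 'I_n -> R) :
  \sum_i F i = \sum_k F (@set_idx n S k) + \sum_k F (@set_idx n (~: S) k).
Proof.
rewrite (bigID (mem S)) /= big_enum_val; congr (_ + _).
by rewrite -big_enum_val; apply: eq_bigl => i; rewrite inE.
Qed.

Lemma mulmx_set_idx (R : pzRingType) (m n : nat) (S : {set 'I_n})
    (M : 'M[R]_(m, n)) (h : 'cV[R]_n) :
  M *m h = cols S M *m subvec S h + cols (~: S) M *m subvec (~: S) h.
Proof.
apply/matrixP => i j; rewrite !mxE (sum_set_idx S).
by congr (_ + _); apply: eq_bigr => k _; rewrite !mxE.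
Qed.

Lemma exists_subvec (R : pzRingType) (n : nat) (S : {set 'I_n})
    (a : 'cV[R]_#|S|) (b : 'cV[R]_#|~: S|) :
  exists2 h : 'cV[R]_n, subvec S h = a & subvec (~: S) h = b.
Proof.
(* Entries return to their original positions; the index sets are disjoint, so the two columns do
   not overlap. *)
exists (\col_i \sum_k (a k 0 *+ (set_idx k == i)) +
        \col_i \sum_k (b k 0 *+ (set_idx k == i))).
  apply/colP => k; rewrite !mxE (bigD1 k) //= eqxx big1 => [|j jk].
    rewrite big1 ?addr0 // => j _; case: eqP => // jk.
    by have := enum_valP j; rewrite -/(set_idx j) jk inE (enum_valP k).
  by rewrite (inj_eq enum_val_inj) (negbTE jk).
apply/colP => k; rewrite !mxE big1 ?add0r => [|j _].
  rewrite (bigD1 k) //= eqxx big1 ?addr0 // => j jk.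
  by rewrite (inj_eq enum_val_inj) (negbTE jk).
case: eqP => // jk.
by have := enum_valP k; rewrite -/(set_idx k) -jk inE (enum_valP j).
Qed.

Lemma subvec_eq0 (R : pzRingType) (n : nat) (S : {set 'I_n}) (h : 'cV[R]_n) :
  subvec S h = 0 -> subvec (~: S) h = 0 -> h = 0.
Proof.
move=> hS hSc; rewrite -[h]mul1mx (mulmx_set_idx S) hS hSc.
by rewrite !mulmx0 addr0.
Qed.

(** * Directional derivative of the l1 norm *)

(* The one-sided directional derivative of [norm1] at [x] along [h]. *)
Definition norm1_dir (R : realType) (n : nat) (x h : 'cV[R]_n) : R :=
  ((sgn_vec (subvec (supp x) x))^T *m subvec (supp x) h) 0 0
  + norm1 (subvec (~: supp x) h).

(** [Num.sg] vanishes off the support, so both parts merge into one sum, comparable with [norm1]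
    term by term. *)
Lemma norm1_dirE (R : realType) (n : nat) (x h : 'cV[R]_n) :
  norm1_dir x h =
  \sum_i (Num.sg (x i 0) * h i 0 + `|h i 0| *+ (x i 0 == 0)).
Proof.
rewrite (sum_set_idx (supp x)) /norm1_dir mxE; congr (_ + _).
  apply: eq_bigr => k _; rewrite !mxE.
  by have := enum_valP k; rewrite inE => /negbTE ->; rewrite addr0.
apply: eq_bigr => k _; rewrite !mxE.
have := enum_valP k; rewrite !inE negbK -/(set_idx k) => /eqP ->.
by rewrite sgr0 mul0r add0r eqxx.
Qed.

Lemma norm1_dirZ (R : realType) (n : nat) (x h : 'cV[R]_n) (e : R) :
  0 <= e -> norm1_dir x (e *: h) = e * norm1_dir x h.
Proof.
move=> e0; rewrite !norm1_dirE mulr_sumr; apply: eq_bigr => i _.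
by rewrite mxE normrM (ger0_norm e0) -mulrnAr mulrCA mulrDr.
Qed.

(** Convexity of the norm: on the support [|x_i + h_i| >= sg(x_i) (x_i + h_i)], and off it equality
    holds. *)
Lemma norm1_dir_le (R : realType) (n : nat) (x h : 'cV[R]_n) :
  norm1 x + norm1_dir x h <= norm1 (x + h).
Proof.
rewrite norm1_dirE -big_split ler_sum //= => i _; rewrite mxE.
case: (sgrP (x i 0)) => [x0|x0|x0].
- by rewrite x0 mul0r !add0r.
- by rewrite mul1r addr0 ler_norm.
- by rewrite mulN1r addr0 -opprD ler_normr lexx orbT.
Qed.

(** No coordinate of the support reverses its sign, so the norm is affine along the step. *)
Lemma norm1_small_step (R : realType) (n : nat) (x h : 'cV[R]_n) :
  (forall i, x i 0 != 0 -> `|h i 0| <= `|x i 0|) ->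
  norm1 (x + h) = norm1 x + norm1_dir x h.
Proof.
move=> hx; rewrite norm1_dirE -big_split; apply: eq_bigr => i _ /=; rewrite mxE.
have := hx i; case: (sgrP (x i 0)) => [x0|x0|x0].
- by rewrite x0 mul0r !add0r.
- rewrite mul1r addr0 => /(_ isT); rewrite ler_norml => /andP[h0 _].
  by rewrite ger0_norm // -lerBlDl sub0r.
- rewrite mulN1r addr0 -opprD => /(_ isT) /ler_normlP[_ h0].
  by rewrite ler0_norm // -lerBrDl sub0r.
Qed.

(** A short step along [h] stays feasible without increasing the norm, so its endpoint is again a
    minimizer and coincides with [x]. *)
Lemma unique_minimizer_dir (R : realType) (m N p : nat)
    (A : 'M[R]_(m, N)) (y : 'cV[R]_m) (C : 'M[R]_(p, N)) (d : 'cV[R]_p)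
    (x h : 'cV[R]_N) :
  unique (minimizer A y C d) x -> A *m h = 0 ->
  (forall i, i \in active_set C d x -> 0 <= (C *m h) i 0) ->
  norm1_dir x h <= 0 -> h = 0.
Proof.
move=> [[[Axy Cxd] xmin] xuniq] Ah Ch h_le0.
(* [e1] prevents sign reversals on the support; [e2] protects the inactive constraints, whose slack
   at [x] is positive. *)
have [e1 e1_gt0 e1P] : exists2 e, 0 < e & forall i, x i 0 != 0 ->
    e * `|h i 0| <= `|x i 0|.
  by apply: exists_small_step => i; rewrite normr_gt0.
have [e2 e2_gt0 e2P] : exists2 e, 0 < e & forall i, i \notin active_set C d x ->
    e * - (C *m h) i 0 <= (C *m x - d) i 0.
  apply: exists_small_step => i; rewrite inE lt_def => ->.
  by move: (Cxd i); rewrite !mxE subr_ge0.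
pose e := Num.min e1 e2.
have e0 : 0 < e by rewrite lt_min e1_gt0.
have zE : norm1 (x + e *: h) <= norm1 x.
  rewrite norm1_small_step => [|i xi].
    by rewrite (norm1_dirZ _ _ (ltW e0)) gerDl pmulr_rle0.
  rewrite mxE normrM gtr0_norm // (le_trans _ (e1P i xi)) // ler_wpM2r //.
  by rewrite ge_min lexx.
have fz : feasible A y C d (x + e *: h).
  split=> [|i]; first by rewrite mulmxDr -scalemxAr Ah scaler0 addr0.
  rewrite mulmxDr -scalemxAr.
  move: (e2P i) (Ch i) (Cxd i); move: (C *m x) (C *m h) => u v; rewrite !mxE.
  case: (boolP (i \in _)) => [_ _ /(_ isT) v0 ud|_ /(_ isT) uv _ dv].
    by rewrite (le_trans ud) // lerDl mulr_ge0 // ltW.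
  have [v0|v0] := leP 0 (v i 0).
    by rewrite (le_trans dv) // lerDl mulr_ge0 // ltW.
  have : e * - v i 0 <= e2 * - v i 0.
    by rewrite ler_wpM2r ?oppr_ge0 ?(ltW v0) // ge_min lexx orbT.
  by move: uv; lra.
have : x = x + e *: h.
  by apply: xuniq; split=> // z /xmin; apply: le_trans.
move/eqP; rewrite -subr_eq0 opprD addNKr oppr_eq0 scaler_eq0 gt_eqF //=.
by move/eqP.
Qed.

Lemma full_column_rankP (R : fieldType) (m n : nat) (M : 'M[R]_(m, n)) :
  full_column_rank M <-> (forall x : 'cV[R]_n, M *m x = 0 -> x = 0).
Proof.
rewrite /full_column_rank -mxrank_tr; split=> [rM x Mx | inj].
  apply: trmx_inj; apply: (@row_free_inj _ _ _ _ M^T); first exact/eqP.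
  by rewrite /= -trmx_mul Mx !trmx0 mul0mx.
apply/eqP; rewrite -/(row_free _) -kermx_eq0; apply/eqP/row_matrixP => i.
rewrite row0; apply: trmx_inj; rewrite trmx0; apply: inj.
by rewrite -{1}[M]trmxK -trmx_mul -row_mul mulmx_ker row0 trmx0.
Qed.

(** Positivity of [e] covers the empty vector, where the maximum takes its default value 0. *)
Lemma norm_infty_lt (R : realType) (n : nat) (x : 'cV[R]_n) (e : R) :
  0 < e -> norm_infty x < e <-> (forall i, `|x i 0| < e).
Proof.
move=> e0; rewrite /norm_infty mx_normrE; split=> [/bigmax_ltP[_ lt_e] i|lt_e].
  exact: (lt_e (i, 0)).
by apply/bigmax_ltP; split=> // -[i j] _; rewrite ord1 lt_e.
Qed.
Theorem corollary4p3 (R : realType) (m N p : nat)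
    (A : 'M[R]_(m, N)) (y : 'cV[R]_m) (C : 'M[R]_(p, N)) (d : 'cV[R]_p)
    (xs : 'cV[R]_N) (xs_feasible : feasible A y C d xs) :
  let alpha := active_set C d xs in
  let S := supp xs in
  let Sc := ~: S in
  let bhat := sgn_vec (subvec S xs) in
  unique (minimizer A y C d) xs <->
  (full_column_rank (col_mx (cols S A) (rows_cols alpha S C)) /\
   exists (u : 'cV[R]_m) (u' : 'cV[R]_#|alpha|),
     [/\ vec_pos u',
         (cols S A)^T *m u + (rows_cols alpha S C)^T *m u' = bhat &
         norm_infty ((cols Sc A)^T *m u + (rows_cols alpha Sc C)^T *m u') < 1]).
Proof.
move=> alpha S Sc bhat; set AS := cols S A; set CS := rows_cols alpha S C.
set ASc := cols Sc A; set CSc := rows_cols alpha Sc C.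
have AE (h : 'cV_N) : A *m h = AS *m subvec S h + ASc *m subvec Sc h.
  exact: mulmx_set_idx.
have CE (h : 'cV_N) :
    subvec alpha (C *m h) = CS *m subvec S h + CSc *m subvec Sc h.
  pose Ca := rowsub (@set_idx p alpha) C.
  have -> : CS = cols S Ca by apply/matrixP => i j; rewrite !mxE.
  have -> : CSc = cols Sc Ca by apply/matrixP => i j; rewrite !mxE.
  rewrite -mulmx_set_idx.
  by apply/matrixP => i j; rewrite !mxE; apply: eq_bigr => k _; rewrite !mxE.
split=> [xs_uniq|[AC_free [u [u' [u'0 ub w_lt1]]]]]; last first.

  (* Sufficiency of (i) and (ii) *)
  suff opt z : feasible A y C d z ->
      norm1 xs <= norm1 z /\ (norm1 z <= norm1 xs -> xs = z).
    split=> [|z [fz zmin]]; last by apply: (opt z fz).2; apply: zmin.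
    by split=> // z /opt[].
  move=> [Azy Czd]; pose h := z - xs.
  have zE : z = xs + h by rewrite addrC subrK.
  pose w := ASc^T *m u + CSc^T *m u'; pose hS := subvec S h.
  pose hSc := subvec Sc h; pose ch := subvec alpha (C *m h).
  have ch_ge0 k : 0 <= ch k 0.
    have Cd : (C *m xs) (set_idx k) 0 = d (set_idx k) 0.
      apply/eqP; rewrite -subr_eq0; have := enum_valP k; rewrite inE.
      by move: (C *m xs) => v; rewrite !mxE.
    rewrite mxE /h mulmxBr; move: Cd (Czd (set_idx k)).
    by move: (C *m xs) (C *m z) => v v' Cd; rewrite !mxE Cd subr_ge0.
  have Ah : AS *m hS + ASc *m hSc = 0.
    by rewrite -AE mulmxBr Azy xs_feasible.1 subrr.
  (* Pairing (ii) with [h] turns [bhat^T *m hS + w^T *m hSc] into [u^T *m (A *m h) + u'^T *m ch],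
     and [A *m h = 0]. *)
  have dirE : norm1_dir xs h =
      \sum_k (`|hSc k 0| - w k 0 * hSc k 0) + \sum_k u' k 0 * ch k 0.
    have : bhat^T *m hS + w^T *m hSc = u'^T *m ch.
      rewrite /ch CE -ub /w !linearD /= !trmx_mul !trmxK !mulmxDl.
      by rewrite addrACA -!mulmxA -mulmxDr Ah mulmx0 add0r.
    move/(congr1 (fun M : 'M_1 => M 0 0)).
    rewrite [LHS]mxE => /(canRL (addrK _)) dirE.
    rewrite /norm1_dir dirE addrC addrA addrAC; congr (_ + _); last first.
      by rewrite mxE; apply: eq_bigr => k _; rewrite mxE.
    rewrite mxE [RHS]sumrB; congr (_ - _).
    by apply: eq_bigr => k _; rewrite mxE.
  have dev_ge0 k : 0 <= `|hSc k 0| - w k 0 * hSc k 0.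
    rewrite subr_ge0 (le_trans (ler_norm _)) // normrM ler_piMl //.
    by rewrite ltW // (norm_infty_lt _ ltr01).1.
  have uch_ge0 k : 0 <= u' k 0 * ch k 0.
    by rewrite mulr_ge0 // ltW.
  have := norm1_dir_le xs h; rewrite -zE dirE => le_z.
  have dev0 : 0 <= \sum_k (`|hSc k 0| - w k 0 * hSc k 0).
    by apply: sumr_ge0.
  have uch0 : 0 <= \sum_k u' k 0 * ch k 0 by apply: sumr_ge0.
  split=> [|z_le]; first by move: le_z dev0 uch0; lra.
  (* If [z] is no worse than [xs], both nonnegative sums vanish, hence termwise: [|w_k| < 1] then
     kills [hSc] and [u' > 0] kills [ch]. Condition (i) finally kills [hS]. *)
  have devE : \sum_k (`|hSc k 0| - w k 0 * hSc k 0) = 0.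
    by move: le_z dev0 uch0 z_le; lra.
  have uchE : \sum_k u' k 0 * ch k 0 = 0.
    by move: le_z dev0 uch0 z_le; lra.
  have hSc0 : hSc = 0.
    apply/colP => k; rewrite [RHS]mxE.
    have /eqP := psumr_eq0P (fun i _ => dev_ge0 i) devE (i := k) isT.
    rewrite subr_eq0 => /eqP hk; apply/eqP; apply: contraT => hk0.
    have : `|hSc k 0| < `|hSc k 0|; last by rewrite ltxx.
    rewrite {1}hk (le_lt_trans (ler_norm _)) // normrM gtr_pMl ?normr_gt0 //.
    exact: (norm_infty_lt _ ltr01).1.
  have ch0 : ch = 0.
    apply/colP => k; rewrite [RHS]mxE; apply/eqP.
    have /eqP := psumr_eq0P (fun i _ => uch_ge0 i) uchE (i := k) isT.
    by rewrite mulf_eq0 gt_eqF.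
  suff h0 : h = 0 by rewrite zE h0 addr0.
  apply: subvec_eq0 (hSc0).
  apply: (full_column_rankP _).1 AC_free _ _.
  rewrite mul_col_mx; move: Ah ch0; rewrite /ch CE -/hS -/hSc hSc0.
  by rewrite !mulmx0 !addr0 => -> ->; rewrite col_mx0.

(* Necessity of (i) and (ii) *)
have stat (hS : 'cV_#|S|) (hSc : 'cV_#|Sc|) :
    AS *m hS + ASc *m hSc = 0 ->
    (forall i j, 0 <= (CS *m hS + CSc *m hSc) i j) ->
    (bhat^T *m hS) 0 0 + norm1 hSc <= 0 -> hS = 0 /\ hSc = 0.
  have [h hSE hScE] := exists_subvec hS hSc.
  rewrite -hSE -hScE -AE -CE => Ah Ch dh.
  suff -> : h = 0 by split; apply/colP => k; rewrite !mxE.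
  apply: unique_minimizer_dir xs_uniq Ah _ dh => i ia.
  by have := Ch (enum_rank_in ia i) 0; rewrite mxE /set_idx enum_rankK_in.
split.
  apply/full_column_rankP => hS; rewrite mul_col_mx -[0]col_mx0.
  case/eq_col_mx => AhS ChS.
  (* For [hS] in the kernel both [hS] and [- hS] are admissible, and at least one has nonpositive
     derivative. *)
  have [le0|/ltW ge0] := leP ((bhat^T *m hS) 0 0) 0.
    apply: (stat hS 0 _ _ _).1; rewrite ?mulmx0 ?addr0 ?AhS ?ChS //.
      by move=> i j; rewrite mxE.
    by rewrite [norm1 0]big1 ?addr0 // => i _; rewrite mxE normr0.
  rewrite -[hS]opprK; apply/eqP; rewrite oppr_eq0; apply/eqP.
  apply: (stat (- hS) 0 _ _ _).1.
  - by rewrite mulmx0 addr0 mulmxN AhS oppr0.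
  - by move=> i j; rewrite mulmx0 addr0 mulmxN ChS oppr0 mxE.
  - rewrite mulmxN [X in X + _]mxE [norm1 0]big1 ?addr0 ?oppr_le0 //.
    by move=> i _; rewrite mxE normr0.
(* The rows of [M] encode, in the unknowns [(h_S, h_Sc, t)], the system
   [- bhat^T h_S - sum t >= 0], [t >= |h_Sc|], [C_alpha h >= 0], [A h = 0]. *)
pose M := col_mx (row_mx (- bhat^T) (row_mx 0 (const_mx (-1))))
  (col_mx (row_mx 0 (row_mx (- 1%:M) 1%:M))
  (col_mx (row_mx 0 (row_mx 1%:M 1%:M))
  (col_mx (row_mx CS (row_mx CSc 0))
  (col_mx (row_mx AS (row_mx ASc 0)) (row_mx (- AS) (row_mx (- ASc) 0)))))).
(* A solution of the system vanishes altogether: [t] dominates [|hSc|], so [stat] gives [hS = 0] and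
   [hSc = 0], and then [sum t <= 0] gives [t = 0]. *)
have [x|Y] := @stiemke R _ _ M.
  rewrite -[x]vsubmxK; move: (usubmx x) (dsubmx x) => hS x'.
  rewrite -[x']vsubmxK; move: (usubmx x') (dsubmx x') => hSc t {x x'}.
  rewrite !(mul_col_mx, mul_row_col) !(mul0mx, mul1mx, addr0, add0r, mulNmx).
  move=> /(@forall_col_mx R (fun z => 0 <= z))[dt].
  move=> /(@forall_col_mx R (fun z => 0 <= z))[th].
  move=> /(@forall_col_mx R (fun z => 0 <= z))[tNh].
  move=> /(@forall_col_mx R (fun z => 0 <= z))[Ch].
  move=> /(@forall_col_mx R (fun z => 0 <= z))[Ah0 Ah1].
  have Ah : AS *m hS + ASc *m hSc = 0.
    apply/matrixP => i j; apply/le_anti; move: (Ah0 i j) (Ah1 i j).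
    by rewrite -opprD; move: (_ + _) => v; rewrite !mxE oppr_ge0 => -> ->.
  have t_le : \sum_k t k 0 <= - (bhat^T *m hS) 0 0.
    move: (dt 0 0); move: (bhat^T *m hS) => e; rewrite !mxE.
    under eq_bigr do rewrite mxE mulN1r.
    by rewrite sumrN subr_ge0.
  have h_le k : `|hSc k 0| <= t k 0.
    move: (th k 0) (tNh k 0); rewrite !mxE ler_norml; lra.
  have norm_le : norm1 hSc <= \sum_k t k 0 by apply: ler_sum.
  have [|hS0 hSc0] := stat _ _ Ah Ch; first by move: t_le norm_le; lra.
  have t0 : t = 0.
    apply/colP => k; rewrite [RHS]mxE.
    have t_ge0 i : 0 <= t i 0 := le_trans (normr_ge0 _) (h_le i).
    apply: (psumr_eq0P (fun i _ => t_ge0 i) _ (i := k) isT).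
    apply/le_anti; rewrite sumr_ge0 // andbT (le_trans t_le) //.
    by rewrite hS0 mulmx0 mxE oppr0.
  by rewrite hS0 hSc0 t0 !(mulmx0, addr0, oppr0) !col_mx0.
(* The multiplier is cut along the row blocks of [M]: [l] for the derivative, [v] and [w] for the
   bounds on [|hSc|], [u'] for [C], [a] and [a'] for the two signs of [A]. *)
rewrite -[Y]vsubmxK; move: (usubmx Y) (dsubmx Y) => l {}Y.
rewrite -[Y]vsubmxK; move: (usubmx Y) (dsubmx Y) => v {}Y.
rewrite -[Y]vsubmxK; move: (usubmx Y) (dsubmx Y) => w {}Y.
rewrite -[Y]vsubmxK; move: (usubmx Y) (dsubmx Y) => u' {}Y.
rewrite -[Y]vsubmxK; move: (usubmx Y) (dsubmx Y) => a a' {Y}.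
move=> /(@forall_col_mx R (fun z => 0 < z))[l0].
move=> /(@forall_col_mx R (fun z => 0 < z))[v0].
move=> /(@forall_col_mx R (fun z => 0 < z))[w0].
move=> /(@forall_col_mx R (fun z => 0 < z))[u'0 _].
rewrite !(tr_col_mx, mul_row_col, tr_row_mx, mul_col_mx, add_col_mx).
move/eqP; rewrite !col_mx_eq0 !(raddfN, trmxK, trmx0, trmx1) /=.
rewrite trmxK trmx1 !(mul0mx, mul1mx, mulNmx, add0r, addr0).
rewrite -!mulmxBr [l]mx11_scalar !mul_mx_scalar.
move: (l 0 0) (l0 0 0) => {l l0} l l0 /and3P[/eqP eqS /eqP eqSc /eqP eqt].
(* The [hS] columns read [AS^T (a - a') + CS^T u' = l bhat]; dividing by [l > 0] normalizes the
   right side. *)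
exists (l^-1 *: (a - a')), (l^-1 *: u'); split.
- by move=> k; rewrite mxE mulr_gt0 ?invr_gt0.
- rewrite -!scalemxAr -scalerDr; apply: (canLR (scalerK _)).
    by rewrite gt_eqF.
  by apply/eqP; rewrite -subr_eq0 addrC [_^T *m _ + _]addrC eqS.
- rewrite -!scalemxAr -scalerDr; apply/(norm_infty_lt _ ltr01) => k.
  have wE : ASc^T *m (a - a') + CSc^T *m u' = v - w.
    apply/eqP; rewrite -subr_eq0 opprB addrC [_^T *m _ + _]addrC.
    by rewrite -addrA addrCA eqSc.
  (* The [t] columns give this, and strict positivity of [v] and [w] yields
     [|v_k - w_k| < v_k + w_k = l]. *)
  have lE : l = v k 0 + w k 0.
    move/colP/(_ k): eqt; rewrite !mxE; lra.
  rewrite wE !mxE normrM gtr0_norm ?invr_gt0 // ltr_pdivrMl // mulr1 lE.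
  by move: (v0 k 0) (w0 k 0); rewrite ltr_norml => *; lra.
Qed.
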